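(* Let $L$ be an even lattice of signature $(2,1)$ and let $k\in\{3/2,\,7/2,\,11/2,\,15/2,\dots\}$. Then every $h\in S_k(\rho_L)$ is antisymmetric under the involution $\iota:\gamma\mapsto-\gamma$ of $D(L)$, and hence $S^O_k(\rho_L)=0$. Consequently $\lambda=0$ on $S_k(\rho_L)$ and $\Xi=0$: no nonzero shadow exists at these weights, for any such lattice.
   Context: $L'$ is the dual lattice of $L$, $D(L)=L'/L$, $q(\gamma)=\tfrac12(\gamma,\gamma)\bmod1$, and $O(D(L),q)$ is the finite group of automorphisms of $D(L)$ preserving $q$. $\rho_L$ is the representation of $\mathrm{Mp}_2(\mathbb Z)$ on $\mathbb C[D(L)]$ with $\rho_L(T)e_\gamma=e(q(\gamma))e_\gamma$ and $\rho_L(S)e_\gamma=\frac{e(-1/8)}{\sqrt{|D(L)|}}\sum_\delta e(-(\gamma,\delta))e_\delta$, $e(x)=e^{2\pi ix}$. $S_k(\rho_L)$ is the space of weight-$k$ cusp forms for $\rho_L$, with $h=\sum_\gamma\sum_{n\in q(\gamma)+\mathbb Z,\,n>0}c_h(\gamma,n)q^ne_\gamma$. $O(D(L),q)$ acts on $S_k(\rho_L)$ through the permutation of the $e_\gamma$, and $S_k^O(\rho_L)$ is the subspace of invariants. Antisymmetric under $\iota$ means $c_h(-\gamma,n)=-c_h(\gamma,n)$ for all $\gamma,n$. For a menu, i.e. a finite set $M\subset\mathbb Q_{>0}$, the functional is $\lambda(h)=\sum_{m\in M}\sum_{\gamma\in D(L):\,q(\gamma)\equiv m\ (\mathrm{mod}\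 1)}c_h(\gamma,m)$, and the shadow $\Xi\in S_k(\rho_L)$ is the element representing $\lambda$ for the Petersson inner product. *)

(* Defs.v *)
From HB Require Import structures.
From mathcomp Require Import all_boot all_order all_algebra.
From mathcomp Require Import perm finmap complex ring.
From mathcomp Require Import all_classical all_reals all_analysis.

Set Implicit Arguments.
Unset Strict Implicit.
Unset Printing Implicit Defensive.

Import Order.TTheory GRing.Theory Num.Theory.
Import numFieldNormedType.Exports.

Local Open Scope classical_set_scope.
Local Open Scope ring_scope.
Local Open Scope complex_scope.
Local Open Scope quotient_scope.

(* A lattice of rank n is given by its Gram matrix in a Z-basis: it is Z^n,
   seen inside the rational quadratic space L (x) Q = Q^n of row vectors. *)
Record evenLattice (n : nat) := EvenLattice {
  gram : 'M[int]_n;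
  gram_sym : gram^T = gram;
  gram_even : forall x : 'rV[int]_n, (2 %| (x *m gram *m x^T)%R ord0 ord0)%Z;
  gram_nondeg : \det gram != 0 }.

Definition has_signature (R : realType) (n : nat) (L : evenLattice n)
    (p m : nat) : Prop :=
  n = (p + m)%N /\
  exists2 P : 'M[R]_n, P \in unitmx &
    P *m map_mx intr (gram L) *m P^T
      = diag_mx (\row_(i < n) (if (i < p)%N then 1 else -1)).

(* The representative in [0, 1[ of the class of x in Q/Z. *)
Definition frac1 (x : rat) : rat := x - (Num.floor x)%:~R.

Section DiscriminantGroup.
Variables (n : nat) (L : evenLattice n).
Implicit Types x y z : 'rV[rat]_n.

Definition bil (x y : 'rV[rat]_n) : rat :=
  (x *m map_mx intr (gram L) *m y^T) 0 0.

Definition in_lattice : {pred 'rV[rat]_n} := [pred x | x \is a mxOver Num.int].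

Fact in_lattice_zmod_closed : zmod_closed in_lattice.
Proof.
split=> [|x y]; first by apply/mxOverP => i j; rewrite mxE rpred0.
by move=> /mxOverP xL /mxOverP yL; apply/mxOverP => i j; rewrite !mxE rpredB.
Qed.
HB.instance Definition _ :=
  GRing.isZmodClosed.Build _ in_lattice in_lattice_zmod_closed.

Definition in_dual : {pred 'rV[rat]_n} :=
  [pred x | `[< forall y, y \in in_lattice -> bil x y \is a Num.int >]].

Lemma bilDl x y z : bil (x + y) z = bil x z + bil y z.
Proof. by rewrite /bil !mulmxDl mxE. Qed.

Lemma bilNl x z : bil (- x) z = - bil x z.
Proof. by rewrite /bil !mulNmx mxE. Qed.

Lemma bilC x y : bil x y = bil y x.
Proof.
rewrite /bil -[in LHS](trmxK (_ *m _)) [in LHS]mxE.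
by rewrite !trmx_mul trmxK map_trmx gram_sym mulmxA.
Qed.

Fact in_dual_zmod_closed : zmod_closed in_dual.
Proof.
split=> [|x y].
  by apply/asboolP => y _; rewrite /bil !mul0mx mxE rpred0.
move=> /asboolP xd /asboolP yd; apply/asboolP => z zL.
by rewrite bilDl bilNl rpredB ?xd ?yd.
Qed.
HB.instance Definition _ :=
  GRing.isZmodClosed.Build _ in_dual in_dual_zmod_closed.

Record dual_lattice := Dual { dual_val :> 'rV[rat]_n; dual_prop : dual_val \in in_dual }.
HB.instance Definition _ := [isSub for dual_val].
HB.instance Definition _ := [Countable of dual_lattice by <:].
HB.instance Definition _ := [SubChoice_isSubZmodule of dual_lattice by <:].

Definition lattice_in_dual : {pred dual_lattice} := [pred x | \val x \in in_lattice].

Fact lattice_in_dual_zmod_closed : zmod_closed lattice_in_dual.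
Proof.
split=> [|x y]; first by rewrite /lattice_in_dual unfold_in; exact: rpred0.
move=> xL yL; rewrite unfold_in; exact: (@rpredB _ in_lattice (\val x) (\val y) xL yL).
Qed.
HB.instance Definition _ :=
  GRing.isZmodClosed.Build _ lattice_in_dual lattice_in_dual_zmod_closed.

(* The discriminant group D(L) = L'/L. *)
Definition disc : Type := Quotient.quot lattice_in_dual.
HB.instance Definition _ := Choice.on disc.
HB.instance Definition _ := GRing.Zmodule.on disc.
HB.instance Definition _ := ZmodQuotient.on disc.

Definition disc_rep (g : disc) : 'rV[rat]_n := \val (repr g).

Lemma discE (u v : dual_lattice) :
  (\pi_disc u == \pi_disc v) = (\val u - \val v \in in_lattice).
Proof. exact/esym/(@Quotient.idealrBE _ lattice_in_dual u v). Qed.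

Lemma lattice_sub_dual x : x \in in_lattice -> x \in in_dual.
Proof.
move=> /mxOverP xL; apply/asboolP => y /mxOverP yL.
rewrite /bil !mxE rpred_sum // => j _; rewrite !mxE rpredM //.
by rewrite rpred_sum // => i _; rewrite !mxE rpredM // Num.Theory.intr_int.
Qed.

(* Finiteness of D(L): with N = |det gram|, N L' is contained in L. *)
Let N : nat := `|\det (gram L)|%N.

Let N_gt0 : (0 < N)%N. Proof. by rewrite absz_gt0 gram_nondeg. Qed.

Let dual_den (x : dual_lattice) i : N%:R * \val x 0 i \is a Num.int.
Proof.
have /asboolP xd := valP x.
have xG j : ((\val x : 'rV_n) *m map_mx intr (gram L)) 0 j \is a Num.int.
  have := xd (delta_mx 0 j); rewrite /bil trmx_delta -colE mxE; apply.
  by apply/mxOverP => a b; rewrite mxE; exact: Num.Theory.natr_int.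
rewrite /N natr_absz intr_norm normrEsg -(det_map_mx intr) -mulrA.
rewrite rpredM //; first by rewrite /Num.sg; do 2?case: ifP => _ //.
have -> : \det (map_mx intr (gram L)) * \val x 0 i =
    (\val x *m map_mx intr (gram L) *m \adj (map_mx intr (gram L))) 0 i.
  by rewrite -mulmxA mul_mx_adj mul_mx_scalar mxE.
rewrite mxE rpred_sum // => j _; rewrite rpredM //.
by rewrite -map_mx_adj mxE Num.Theory.intr_int.
Qed.

Definition disc_code (g : disc) : {ffun 'I_n -> 'I_N.+1} :=
  [ffun i => inord `|(Num.floor (N%:R * disc_rep g 0 i)%R %% N)%Z|%N].

Definition disc_decode (t : {ffun 'I_n -> 'I_N.+1}) : option disc :=
  omap \pi_disc (insub (\row_i ((t i)%:R / N%:R))).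

Fact disc_codeK : pcancel disc_code disc_decode.
Proof.
move=> g; rewrite /disc_decode; set v := \row_i _.
have N0 : (N%:R : rat) != 0 by rewrite pnatr_eq0 -lt0n.
have vg : v - disc_rep g \in in_lattice.
  apply/mxOverP => a i; rewrite {a}ord1 !mxE ffunE.
  have /intrP[z zE] := dual_den (repr g) i.
  rewrite -/(disc_rep g) in zE; rewrite zE intrKfloor.
  have zm0 : (0 <= z %% N)%Z by rewrite modz_ge0 // gt_eqF.
  rewrite inordK; last first.
    by rewrite ltnS -lez_nat gez0_abs // ltW // ltz_pmod.
  have -> : disc_rep g 0 i = z%:~R / N%:R by rewrite -zE mulrAC divff ?mul1r.
  rewrite -mulrBl -[_%:R]/(Posz _)%:~R gez0_abs // {2}(divz_eq z N) -intrB.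
  rewrite opprD addrCA subrr addr0 intrN intrM mulNr mulfK //.
  by rewrite rpredN Num.Theory.intr_int.
have vd : v \in in_dual.
  rewrite -[v](subrK (disc_rep g)); apply: rpredD; first exact: lattice_sub_dual.
  exact: dual_prop.
rewrite insubT /=; congr Some; rewrite -[RHS]reprK; apply/eqP; rewrite discE.
exact: vg.
Qed.

HB.instance Definition _ := PCanIsCountable disc_codeK.
HB.instance Definition _ := fintype.isFinite.Build disc (pcan_enumP disc_codeK).

Lemma frac1_eq (a b : rat) : a - b \is a Num.int -> frac1 a = frac1 b.
Proof.
move=> /intrP[m abm]; have -> : a = b + m%:~R by rewrite -abm addrC subrK.
rewrite /frac1 floorDrz ?Num.Theory.intr_int // intrKfloor intrD opprD.
by rewrite addrACA subrr addr0.
Qed.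

(* q(g) and (g, d) are classes in Q/Z; both are given by their representative in
   [0, 1[.  They do not depend on this choice: see discq_pi and discb_pi. *)
Definition discq (g : disc) : rat := frac1 (bil (disc_rep g) (disc_rep g) / 2).

Definition discb (g d : disc) : rat := frac1 (bil (disc_rep g) (disc_rep d)).

Lemma disc_rep_pi (u : dual_lattice) : disc_rep (\pi_disc u) - \val u \in in_lattice.
Proof. by rewrite /disc_rep -discE reprK. Qed.

Lemma discq_pi (u : dual_lattice) :
  discq (\pi_disc u) = frac1 (bil (\val u) (\val u) / 2).
Proof.
have /asboolP ud := valP u; rewrite /discq; set x := disc_rep (\pi_disc u).
have [l lL ->] : exists2 l, l \in in_lattice & x = \val u + l.
  by exists (x - \val u); [exact: disc_rep_pi | rewrite addrC subrK].
apply: frac1_eq.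
have ulZ := ud _ lL.
have llZ : bil l l / 2 \is a Num.int.
  have [y ly] : exists y : 'rV[int]_n, l = map_mx intr y.
    exists (\row_j Num.floor (l 0 j)); apply/rowP => j; rewrite !mxE floorK //.
    by have /mxOverP := lL; apply.
  rewrite /bil ly map_trmx -!map_mxM mxE.
  have /dvdzP[c ->] := gram_even L y.
  by rewrite /= intrM mulfK // Num.Theory.intr_int.
have -> : bil (\val u + l) (\val u + l) / 2 - bil (\val u) (\val u) / 2 =
    bil (\val u) l + bil l l / 2.
  by rewrite bilDl !(bilC _ (_ + l)) !bilDl (bilC l (\val u)); field.
by rewrite rpredD.
Qed.

Lemma discb_pi (u v : dual_lattice) :
  discb (\pi_disc u) (\pi_disc v) = frac1 (bil (\val u) (\val v)).
Proof.
rewrite /discb; apply: frac1_eq.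
set x := disc_rep _; set y := disc_rep (\pi_disc v).
have -> : bil x y - bil (\val u) (\val v) =
    bil (x - \val u) y + bil (\val u) (y - \val v).
  by rewrite !(bilC _ (_ - _)) !bilDl !bilNl !(bilC (\val u)) (bilC y); ring.
rewrite rpredD //.
  rewrite bilC; have /asboolP := dual_prop (repr (\pi_disc v)); apply.
  exact: disc_rep_pi.
by have /asboolP := valP u; apply; exact: disc_rep_pi.
Qed.

End DiscriminantGroup.

Section UpperHalfPlane.
Variable R : realType.
Local Notation C := R[i].
Implicit Types z w : C.

Record uhp := Uhp { uhp_val :> C; uhp_gt0 : 0 < complex.Im uhp_val }.
HB.instance Definition _ := [isSub for uhp_val].
Implicit Types t : uhp.

Definition uhp_ext (f : uhp -> C) (z : C) : C :=
  if insub z is Some t then f t else 0.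

(* The limits are taken over C, so that this is complex differentiability. *)
Definition holomorphic (f : uhp -> C) : Prop :=
  forall t, derivable (uhp_ext f : C^o -> C^o) (\val t) 1.

Lemma uhp_extE f t : uhp_ext f (\val t) = f t.
Proof. by rewrite /uhp_ext valK. Qed.

Lemma normc_ge_Im z : `|complex.Im z|%:C <= `|z|.
Proof.
case: z => a b; rewrite normc_def lecR /= -(sqrtr_sqr b).
by apply: ler_wsqrtr; rewrite lerDr sqr_ge0.
Qed.

Lemma uhp_open t : \forall z \near (\val t : C^o), 0 < complex.Im z.
Proof.
have t0 : 0 < (complex.Im (\val t))%:C :> C by rewrite ltcR; exact: uhp_gt0.
apply/nbhs_ballP; exists (complex.Im (\val t))%:C => //= z.
rewrite -ball_normE /= => /(le_lt_trans (normc_ge_Im _)).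
rewrite ltcR raddfB /= => h; have := le_lt_trans (ler_norm _) h.
by rewrite ltrBlDr ltrDl.
Qed.

Lemma holomorphic_cst c : holomorphic (fun=> c).
Proof.
move=> t; apply: (@near_eq_derivable _ _ _ (cst c : C^o -> C^o)).
  by near=> z; rewrite /uhp_ext insubT //; near: z; exact: uhp_open.
exact: derivable_cst.
Unshelve. all: by end_near. Qed.

Lemma holomorphicM f g :
  holomorphic f -> holomorphic g -> holomorphic (fun t => f t * g t).
Proof.
move=> hf hg t; have -> : uhp_ext (fun t => f t * g t) =
    ((uhp_ext f : C^o -> C) * (uhp_ext g : C^o -> C))%R.
  by apply/funext => z; rewrite /uhp_ext fctE; case: insub => //; rewrite mulr0.
exact: (@derivableM C C^o).
Qed.

Lemma holomorphicV f :
  (forall t, f t != 0) -> holomorphic f -> holomorphic (fun t => (f t)^-1).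
Proof.
move=> f0 hf t; have -> : uhp_ext (fun t => (f t)^-1) =
    (fun z : C^o => (uhp_ext f z)^-1).
  by apply/funext => z; rewrite /uhp_ext; case: insub => //; rewrite invr0.
by apply: (@derivableV C C^o); [rewrite uhp_extE | exact: hf].
Qed.

Definition mobden (A : 'M[int]_2) (z : C) : C := (A 1 0)%:~R * z + (A 1 1)%:~R.
Definition mobnum (A : 'M[int]_2) (z : C) : C := (A 0 0)%:~R * z + (A 0 1)%:~R.

Lemma det2E (A : 'M[int]_2) : \det A = A 0 0 * A 1 1 - A 0 1 * A 1 0.
Proof.
rewrite (expand_det_row _ 0) !big_ord_recl big_ord0 /cofactor !det_mx11 !mxE /=.
have e01 : lift 0 0 = 1 :> 'I_2 by exact/val_inj.
have e10 : lift 1 0 = 0 :> 'I_2 by exact/val_inj.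
by rewrite !e01 e10 expr0 expr1 mul1r mulN1r addr0 mulrN.
Qed.

Lemma mulmx2E (A B : 'M[int]_2) i j :
  (A *m B) i j = A i 0 * B 0 j + A i 1 * B 1 j.
Proof.
rewrite mxE !big_ord_recl big_ord0 addr0.
by have -> : lift ord0 ord0 = 1 :> 'I_2 by exact/val_inj.
Qed.

Record SL2Z := SL2 { SL2_mx :> 'M[int]_2; SL2_det : \det SL2_mx = 1 }.
Implicit Types A B : SL2Z.

Lemma mobden_neq0 A t : mobden A (\val t) != 0.
Proof.
case: t => [[x y] /= y0]; apply/eqP => /eqP.
rewrite /mobden -!(rmorph_int (real_complex R)) /=; simpc.
rewrite eq_complex /= mulf_eq0 intr_eq0 (gt_eqF y0) orbF => /andP[/[swap] /eqP c0].
rewrite c0 mul0r add0r intr_eq0 => /eqP d0.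
by have := SL2_det A; rewrite det2E c0 d0 !mulr0.
Qed.

Fact mobius_subproof A t :
  0 < complex.Im (mobnum A (\val t) / mobden A (\val t)).
Proof.
have := mobden_neq0 A t; case: t => [[x y] /= y0].
rewrite /mobden /mobnum -!(rmorph_int (real_complex R)) /=; simpc.
set a : R := (A 0 0)%:~R; set b : R := (A 0 1)%:~R.
set c : R := (A 1 0)%:~R; set d : R := (A 1 1)%:~R => n0.
have abcd : a * d - b * c = 1 by rewrite /a /b /c /d -!intrM -intrB -det2E SL2_det.
have n_gt0 : 0 < (c * x + d) ^+ 2 + (c * y) ^+ 2.
  rewrite lt_neqAle addr_ge0 ?sqr_ge0 // andbT eq_sym paddr_eq0 ?sqr_ge0 //.
  by rewrite !sqrf_eq0; move: n0; rewrite eq_complex.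
rewrite [X in _ < X](_ : _ = y * (a * d - b * c) / ((c * x + d) ^+ 2 + (c * y) ^+ 2)).
  by rewrite abcd mulr1 divr_gt0.
by field; rewrite gt_eqF.
Qed.

(* The action of SL_2(Z) on the upper half-plane. *)
Definition mobius A t : uhp := Uhp (mobius_subproof A t).

Fact SL2_mul_subproof A B : \det (A *m B) = 1.
Proof. by rewrite det_mulmx !SL2_det mulr1. Qed.
Definition SL2_mul A B := SL2 (SL2_mul_subproof A B).

Definition SL2_one : SL2Z := SL2 (det1 _ _).

Fact SL2_inv_subproof A : \det (\adj A) = 1.
Proof.
by have := congr1 determinant (mul_mx_adj A); rewrite det_mulmx SL2_det mul1r det1.
Qed.
Definition SL2_inv A := SL2 (SL2_inv_subproof A).

Lemma SL2_inj A B : SL2_mx A = SL2_mx B -> A = B.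
Proof. by case: A B => [A ?] [B ?] /= AB; subst B; congr SL2; exact: Prop_irrelevance. Qed.

Lemma mobdenM A B t :
  mobden (SL2_mul A B) (\val t) = mobden A (\val (mobius B t)) * mobden B (\val t).
Proof.
rewrite /= /mobden !mulmx2E mulrDl -mulrA divfK ?mobden_neq0 //.
by rewrite /mobnum /mobden !intrD !intrM; ring.
Qed.

Lemma mobiusM A B t : mobius (SL2_mul A B) t = mobius A (mobius B t).
Proof.
apply: val_inj; rewrite [LHS]/= mobdenM [RHS]/=.
have dB := mobden_neq0 B t.
have -> : mobnum (A *m B) (\val t) = mobnum A (mobius B t) * mobden B (\val t).
  rewrite /= /mobnum !mulmx2E mulrDl -mulrA divfK //.
  by rewrite /mobnum /mobden !intrD !intrM; ring.
by rewrite -mulf_div divff // mulr1.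
Qed.

Lemma mobius1 t : mobius SL2_one t = t.
Proof.
apply: val_inj; rewrite /= /mobnum /mobden !mxE /=.
by rewrite mul1r mul0r addr0 add0r divr1.
Qed.

Lemma holomorphic_mobius f A : holomorphic f -> holomorphic (f \o mobius A).
Proof.
move=> hf t; pose m (z : C^o) : C^o := mobnum A z / mobden A z.
apply: (@near_eq_derivable _ _ _ ((uhp_ext f : C^o -> C^o) \o m)).
  near=> z; have z0 : 0 < complex.Im z by near: z; exact: uhp_open.
  by rewrite /uhp_ext insubT /= insubT ?(mobius_subproof A (Uhp z0)) // => h;
     congr f; exact: val_inj.
apply/derivable1_diffP; apply: differentiable_comp; last first.
  by apply/derivable1_diffP; exact: (hf (mobius A t)).
have aff (a b : C) : derivable (fun z : C^o => a * z + b : C^o) (\val t) 1.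
  apply: (@derivableD C C^o C^o); last exact: derivable_cst.
  by apply: (@derivableM C C^o); [exact: derivable_cst|exact: derivable_id].
apply/derivable1_diffP; apply: (@derivableM C C^o); first exact: aff.
by apply: (@derivableV C C^o); [exact: mobden_neq0 | exact: aff].
Unshelve. all: by end_near. Qed.

End UpperHalfPlane.

Section Mp2.
Variable R : realType.
Local Notation C := R[i].
Implicit Types t : uhp R.

Lemma sqrtc_Re_gt0 t : 0 < complex.Re (sqrtc (\val t)).
Proof.
case: t => [[a b] /= b0]; rewrite sqrtr_gt0 divr_gt0 // -ltrBlDr sub0r.
apply: le_lt_trans (ler_norm (- a)) _; rewrite normrN -sqrtr_sqr ltr_sqrt.
  by rewrite ltrDl exprn_gt0.
by rewrite ltr_wpDl ?sqr_ge0 // exprn_gt0.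
Qed.

Lemma sqrtc_holomorphic : holomorphic (fun t => sqrtc (\val t)).
Proof.
move=> t; set z0 := \val t; set s0 := sqrtc z0.
have s0R : 0 < (complex.Re s0)%:C :> C by rewrite ltcR sqrtc_Re_gt0.
apply: (@near_eq_derivable _ _ _ (fun z : C^o => sqrtc z : C^o)).
  near=> z; have z_gt0 : 0 < complex.Im z by near: z; exact: uhp_open.
  by rewrite /uhp_ext insubT.
have lower (z : C) : 0 < complex.Im z -> (complex.Re s0)%:C <= `|sqrtc z + s0|.
  move=> zI; apply: le_trans (normc_ge_Re _); rewrite lecR raddfD /=.
  apply: le_trans (ler_norm _); rewrite lerDr ltW //.
  exact: (sqrtc_Re_gt0 (Uhp zI)).
have diffE (z : C) : (sqrtc z - s0) * (sqrtc z + s0) = z - z0.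
  by rewrite -subr_sqr !sqr_sqrtc.
have nearI : \forall h \near (0 : C^o), 0 < complex.Im (h + z0).
  have /nbhs0P := uhp_open t; by apply: (filterS (F := nbhs (0 : C^o))) => h; rewrite addrC.
have cont : (fun h : C^o => sqrtc (h + z0) + s0 : C^o) @ (0 : C^o) --> (s0 + s0 : C^o).
  apply/(@cvgrPdist_lt C C^o C^o (nbhs (0 : C^o)) (nbhs_filter _)) => e e0.
  have es : 0 < e * (complex.Re s0)%:C by rewrite mulr_gt0.
  have := @nbhs0_lt C C^o _ es.
  apply: (filterS2 (F := nbhs (0 : C^o))) nearI => h hI he.
  rewrite opprD addrACA subrr addr0 -normrN opprB.
  have sn0 : 0 < `|sqrtc (h + z0) + s0| := lt_le_trans s0R (lower _ hI).
  rewrite -(ltr_pM2r sn0) -normrM diffE addrK (lt_le_trans he) //.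
  by rewrite ler_pM2l // lower.
have ss0 : s0 + s0 != 0.
  by rewrite -normr_gt0; apply: lt_le_trans s0R (lower _ _); exact: uhp_gt0.
apply/cvg_ex; exists ((s0 + s0)^-1 : C^o).
have cV := @cvgV C C^o _ (nbhs_filter (0 : C^o)) _ _ ss0 cont.
have cont' := @cvg_within_filter _ _ _ _ (nbhs_filter _) _ (fun h => h != 0) cV.
apply: cvg_trans cont'; apply: near_eq_cvg.
have nearI' : \forall h \near (0 : C^o)^', 0 < complex.Im (h + z0).
  exact: cvg_within nearI.
have near0 : \forall h \near (0 : C^o)^', h != 0 by exact: withinT.
apply: filterS2 nearI' near0 => h hI h0 /=.
have sn0 : sqrtc (h + z0) + s0 != 0.
  by rewrite -normr_gt0; exact: lt_le_trans s0R (lower _ hI).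
rewrite [_ *: 1](mulr1 h) -/z0 -/s0 -[RHS]/(h^-1 * (sqrtc (h + z0) - s0)).
rewrite -[sqrtc (h + z0) - s0](mulfK sn0) diffE addrK.
by rewrite mulrA mulVf // mul1r.
Unshelve. all: by end_near. Qed.

(* The metaplectic group: pairs (A, phi) with A in SL_2(Z) and phi holomorphic on
   the upper half-plane with phi(t)^2 = c t + d, under the product
   (A, phi) (B, psi) = (A B, t |-> phi(B t) psi(t)). *)
Record Mp2 := Mp2_of {
  mp_mx : SL2Z;
  mp_root : uhp R -> C;
  mp_hol : holomorphic mp_root;
  mp_sqr : forall t, mp_root t ^+ 2 = mobden mp_mx (\val t) }.
HB.instance Definition _ := gen_eqMixin Mp2.
HB.instance Definition _ := gen_choiceMixin Mp2.
Implicit Types g h : Mp2.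

Lemma mp_root_neq0 g t : mp_root g t != 0.
Proof. by rewrite -sqrf_eq0 mp_sqr mobden_neq0. Qed.

Lemma mp_eq g h :
  SL2_mx (mp_mx g) = SL2_mx (mp_mx h) -> (forall t, mp_root g t = mp_root h t) -> g = h.
Proof.
case: g h => [A f Af Af2] [B f' Bf Bf2] /= /SL2_inj AB /funext ff'; subst B f'.
by congr Mp2_of; exact: Prop_irrelevance.
Qed.

Fact mp_mul_hol g h :
  holomorphic (fun t => mp_root g (mobius (mp_mx h) t) * mp_root h t).
Proof.
apply: holomorphicM; last exact: mp_hol.
exact: (@holomorphic_mobius R _ (mp_mx h) (@mp_hol g)).
Qed.

Fact mp_mul_sqr g h t :
  (mp_root g (mobius (mp_mx h) t) * mp_root h t) ^+ 2 =
  mobden (SL2_mul (mp_mx g) (mp_mx h)) (\val t).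
Proof. by rewrite exprMn !mp_sqr mobdenM. Qed.

Definition mp_mul g h := Mp2_of (@mp_mul_hol g h) (mp_mul_sqr g h).

Fact mp_one_sqr t : 1 ^+ 2 = mobden SL2_one (\val t) :> C.
Proof. by rewrite expr1n /mobden !mxE mul0r add0r. Qed.

Definition mp_one := Mp2_of (@holomorphic_cst R 1) mp_one_sqr.

Fact mp_inv_hol g :
  holomorphic (fun t => (mp_root g (mobius (SL2_inv (mp_mx g)) t))^-1).
Proof.
apply: holomorphicV => [t|]; first exact: mp_root_neq0.
exact: (@holomorphic_mobius R _ (SL2_inv (mp_mx g)) (@mp_hol g)).
Qed.

Lemma SL2_mulV (A : SL2Z) : SL2_mul A (SL2_inv A) = SL2_one.
Proof. by apply: SL2_inj; rewrite /= mul_mx_adj SL2_det. Qed.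

Lemma SL2_Vmul (A : SL2Z) : SL2_mul (SL2_inv A) A = SL2_one.
Proof. by apply: SL2_inj; rewrite /= mul_adj_mx SL2_det. Qed.

Fact mp_inv_sqr g t :
  (mp_root g (mobius (SL2_inv (mp_mx g)) t))^-1 ^+ 2 =
  mobden (SL2_inv (mp_mx g)) (\val t).
Proof.
rewrite exprVn mp_sqr; apply: (mulfI (mobden_neq0 (mp_mx g) (mobius (SL2_inv (mp_mx g)) t))).
by rewrite divff ?mobden_neq0 // -mobdenM SL2_mulV -mp_one_sqr expr1n.
Qed.

Definition mp_inv g := Mp2_of (@mp_inv_hol g) (mp_inv_sqr g).

Fact mp_mulA : associative mp_mul.
Proof.
by move=> f g h; apply: mp_eq => [|t] /=; rewrite ?mulmxA // mobiusM mulrA.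
Qed.

Fact mp_mul1 : left_id mp_one mp_mul.
Proof. by move=> g; apply: mp_eq => [|t] /=; rewrite ?mul1mx ?mul1r. Qed.

Fact mp_mulr1 : right_id mp_one mp_mul.
Proof.
by move=> g; apply: mp_eq => [|t] /=; rewrite ?mulmx1 // mobius1 mulr1.
Qed.

Fact mp_mulV : left_inverse mp_one mp_inv mp_mul.
Proof.
move=> g; apply: mp_eq => [|t] /=; first by rewrite mul_adj_mx SL2_det.
by rewrite -mobiusM SL2_Vmul mobius1 mulVf ?mp_root_neq0.
Qed.

Fact mp_mulrV : right_inverse mp_one mp_inv mp_mul.
Proof.
move=> g; apply: mp_eq => [|t] /=; first by rewrite mul_mx_adj SL2_det.
by rewrite divff ?mp_root_neq0.
Qed.

HB.instance Definition _ :=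
  isGroup.Build Mp2 mp_mulA mp_mul1 mp_mulr1 mp_mulV mp_mulrV.

Definition T_mx : 'M[int]_2 := \matrix_(i, j) (if (i <= j)%N then 1 else 0).
Definition S_mx : 'M[int]_2 :=
  \matrix_(i, j) (if i == j then 0 else if (i < j)%N then -1 else 1).

Fact T_det : \det T_mx = 1. Proof. by rewrite det2E !mxE. Qed.
Fact S_det : \det S_mx = 1. Proof. by rewrite det2E !mxE. Qed.

Fact T_sqr t : 1 ^+ 2 = mobden T_mx (\val t) :> C.
Proof. by rewrite /mobden !mxE /= mul0r add0r expr1n. Qed.

Fact S_sqr t : sqrtc (\val t) ^+ 2 = mobden S_mx (\val t) :> C.
Proof. by rewrite /mobden !mxE /= mul1r addr0 sqr_sqrtc. Qed.

Definition mpT : Mp2 := @Mp2_of (SL2 T_det) _ (@holomorphic_cst R 1) T_sqr.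
Definition mpS : Mp2 := @Mp2_of (SL2 S_det) _ sqrtc_holomorphic S_sqr.

End Mp2.

Section CuspForms.
Variables (R : realType) (n : nat) (L : evenLattice n).
Local Notation C := R[i].
Local Notation D := (disc L).
Implicit Types (g d : D) (t : uhp R) (k m : rat) (M : {fset rat}).

Definition cexp (z : C) : C :=
  (expR (complex.Re z))%:C * (cos (complex.Im z) +i* sin (complex.Im z)).

Definition e2ipi (z : C) : C := cexp (2 * pi%:C * 'i%C * z).

(* The space C[D(L)], with its basis (e_g). *)
Definition discC : Type := {ffun D -> C^o}.
HB.instance Definition _ := Vector.on discC.

Definition disc_basis g : discC := [ffun d => (d == g)%:R].

Definition is_weil_representation (rho : Mp2 R -> 'End(discC)) : Prop :=
  [/\ rho 1%g = \1%VF,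
      forall a b, rho (a * b)%g = (rho a \o rho b)%VF,
      forall g, rho (mpT R) (disc_basis g) = e2ipi (ratr (discq g)) *: disc_basis g
    & forall g, rho (mpS R) (disc_basis g) =
        (e2ipi (- (1 / 8)) / (Num.sqrt (#|{: D}|%:R : R))%:C) *:
          \sum_d e2ipi (- ratr (discb g d)) *: disc_basis d].

(* c is the family of Fourier coefficients of h: it is supported on the n > 0 in
   q(g) + Z, and the g-component of h(t) is the sum of the c(g, n) e2ipi(n t).  The n >= 0
   in q(g) + Z are the discq g + j for j a natural number. *)
Definition is_fourier (h : uhp R -> discC) (c : D -> rat -> C) : Prop :=
  (forall g m, c g m != 0 -> 0 < m /\ m - discq g \is a Num.int) /\
  (forall g t, series (fun j : nat =>
       c g (discq g + j%:R) * e2ipi (ratr (discq g + j%:R) * \val t) : C^o) @ \oo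
     --> (h t g : C^o)).

Definition fourier_coef (h : uhp R -> discC) : D -> rat -> C :=
  xget (fun _ _ => 0) [set c | is_fourier h c].

(* The weight k is a half-integer, so that numq (2 * k) is the integer 2k. *)
Definition cusp_forms (rho : Mp2 R -> 'End(discC)) k : set (uhp R -> discC) :=
  [set h : uhp R -> discC | [/\ forall g, holomorphic (fun t => h t g),
      forall a t, h (mobius (mp_mx a) t) =
        (mp_root a t ^ numq (2 * k)) *: rho a (h t)
    & exists c, is_fourier h c]].

Definition iota_antisymmetric (h : uhp R -> discC) : Prop :=
  forall g m, fourier_coef h (- g) m = - fourier_coef h g m.

Definition disc_isometries : set {perm D} :=
  [set s : {perm D} | {morph s : x y / x + y} /\ forall x, discq (s x) = discq x].

Definition disc_permute (s : {perm D}) (v : discC) : discC :=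
  \sum_g v g *: disc_basis (s g).

Definition invariant_cusp_forms (rho : Mp2 R -> 'End(discC)) k :
    set (uhp R -> discC) :=
  [set h : uhp R -> discC | cusp_forms rho k h /\
     forall s, disc_isometries s -> forall t, disc_permute s (h t) = h t].

Definition menu_functional M (h : uhp R -> discC) : C :=
  \sum_(m <- M) \sum_(g | discq g - m \is a Num.int) fourier_coef h g m.

(* The standard fundamental domain, in the coordinates (x, y) of t = x + i y. *)
Definition fund_domain : set (R * R) :=
  [set p | [/\ `|p.1| <= 1 / 2, 0 < p.2 & 1 <= p.1 ^+ 2 + p.2 ^+ 2]].

Definition Cintegral (A : set (R * R)) (f : R * R -> C) : C :=
  let mu := (@lebesgue_measure R \x @lebesgue_measure R)%E in
  Rintegral mu A (fun p => complex.Re (f p)) +i*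
  Rintegral mu A (fun p => complex.Im (f p)).

Definition petersson k (f h : uhp R -> discC) : C :=
  Cintegral fund_domain (fun p =>
    uhp_ext (fun t => \sum_g (f t g : C) * (h t g : C)^*) (p.1 +i* p.2)
    * (p.2 `^ (ratr k - 2))%:C).

Definition is_shadow (rho : Mp2 R -> 'End(discC)) k M
    (Xi : uhp R -> discC) : Prop :=
  cusp_forms rho k Xi /\
  forall h, cusp_forms rho k h -> menu_functional M h = petersson k h Xi.

End CuspForms.

(* Main.v *)
(* Let Z = S^2 in Mp_2(Z). It acts trivially on the upper half-plane, its root is
   sqrt(-1/t) sqrt(t) = i, and rho_L(Z) e_g = e(-1/4) e_(-g) by orthogonality of
   the characters (g, .) of D(L). As i^(2k) = -i when 2k = 3 mod 4, modularity
   under Z reads h_g = (-i)(-i) h_(-g) = - h_(-g), and uniqueness of Fourier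
   expansions carries the sign over to the coefficients. Invariance under the
   isometry g |-> -g then forces h = 0, and the terms of the functional at g and -g
   cancel. A shadow is therefore orthogonal to itself. It vanishes because the
   Petersson norm of a nonzero cusp form is positive: the integrand is nonnegative,
   decays exponentially at the cusp, and is bounded below on a rectangle
   high in the cusp, where the leading Fourier term dominates. *)

Require Import Defs.
From mathcomp Require Import all_boot all_order all_algebra.
From mathcomp Require Import perm finmap complex ring lra.
From mathcomp Require Import all_classical all_reals all_analysis.
From mathcomp Require Import measurable_realfun exponential_distribution.

Set Implicit Arguments.
Unset Strict Implicit.
Unset Printing Implicit Defensive.

Import Order.TTheory GRing.Theory Num.Theory.
Import numFieldNormedType.Exports.

Local Open Scope classical_set_scope.
Local Open Scope ring_scope.
Local Open Scope complex_scope.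

(** * Positivity of integrals over a vertical strip *)

(* No measurability is assumed: the integral of a nonnegative function is a supremum
   over the simple functions below it. *)
Lemma le_integral_ge0 d (T : measurableType d) (R : realType)
    (mu : {measure set T -> \bar R}) (f g : T -> \bar R) :
  (forall x, 0 <= f x)%E -> (forall x, f x <= g x)%E ->
  (\int[mu]_x f x <= \int[mu]_x g x)%E.
Proof.
move=> f0 fg; have g0 x : (0 <= g x)%E by exact: le_trans (f0 x) (fg x).
rewrite !ge0_integralTE // ge_ereal_sup // => _ [h hf <-].
by apply: ereal_sup_ubound; exists h => // x; exact: le_trans (hf x) (fg x).
Qed.

(** The integral is at least [e] times the measure of [B]. The majorant [g] keeps it finite, which
    matters because [Rintegral] applies [fine], and [fine] sends an infinite value to 0. *)
Lemma Rintegral_gt0 d (T : measurableType d) (R : realType)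
    (mu : {measure set T -> \bar R}) (A B : set T) (f g : T -> R) (e : R) :
  measurable B -> B `<=` A -> (0 < mu B)%E ->
  0 < e -> (forall x, B x -> e <= f x) ->
  (forall x, A x -> 0 <= f x <= g x) -> (forall x, 0 <= g x) ->
  (\int[mu]_x (g x)%:E < +oo)%E ->
  0 < Rintegral mu A f.
Proof.
move=> mB BA B0 e0 fB fA g0 gfin.
have F0 x : (0 <= ((fun x => (f x)%:E) \_ A) x)%E.
  by rewrite patchE; case: ifPn => // /set_mem /fA /andP[? _]; rewrite lee_fin.
rewrite /Rintegral; apply: fine_gt0; rewrite integral_mkcond.
apply/andP; split.
  apply: (@lt_le_trans _ _ (\int[mu]_x (e%:E * (\1_B x)%:E))%E).
    rewrite ge0_integralZl_EFin //; last 2 first.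
    - by apply/measurable_EFinP; exact: measurable_indic.
    - exact: ltW.
    by rewrite integral_indic // setIT mule_gt0.
  apply: le_integral_ge0 => x; first by rewrite -EFinM lee_fin mulr_ge0 // ltW.
  rewrite -EFinM indicE; case: (boolP (x \in B)) => [/set_mem xB|_].
    by rewrite patchE mem_set ?lee_fin ?mulr1; [exact: fB|exact: BA].
  by rewrite mulr0; exact: F0.
apply: le_lt_trans gfin; apply: le_integral_ge0 => // x; rewrite patchE.
by case: ifPn => [/set_mem /fA /andP[_]|_]; rewrite lee_fin.
Qed.

(** This is the shape of the Petersson integral: exponential decay in the second coordinate gives
    finiteness, and a rectangle of area 1 carries the lower bound. *)
Lemma Rintegral_strip_gt0 (R : realType) (A : set (R * R)) (f : R * R -> R)
    (b K e Y : R) :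
  0 < b -> 0 < e ->
  (forall p, A p -> `|p.1| <= 1 / 2 /\ 0 <= p.2) ->
  (forall p, `|p.1| <= 1 / 2 -> Y <= p.2 <= Y + 1 -> A p) ->
  (forall p, A p -> 0 <= f p <= K * expR (- b * p.2)) ->
  (forall p, `|p.1| <= 1 / 2 -> Y <= p.2 <= Y + 1 -> e <= f p) ->
  0 < Rintegral (@lebesgue_measure R \x @lebesgue_measure R)%E A f.
Proof.
move=> b0 e0 A1 A2 f1 f2.
have hI : (- (1 / 2) : R) < 1 / 2 by lra.
pose I : set R := `[- (1 / 2), 1 / 2]%classic.
pose J : set R := `[Y, Y + 1]%classic.
have inI (x : R) : I x <-> `|x| <= 1 / 2 by rewrite /I /= in_itv /= ler_norml.
have mI : measurable I by exact: measurable_itv.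
have mJ : measurable J by exact: measurable_itv.
have muI : @lebesgue_measure R I = 1%:E.
  by rewrite lebesgue_measure_itv /= lte_fin hI -EFinD; congr EFin; lra.
have muJ : @lebesgue_measure R J = 1%:E.
  rewrite lebesgue_measure_itv /= lte_fin ltrDl ltr01 -EFinD; congr EFin; lra.
have muIJ : (0 < (@lebesgue_measure R \x @lebesgue_measure R) (I `*` J))%E.
  rewrite product_measure1E // [X in (_ < X * _)%E]muI [X in (_ < _ * X)%E]muJ.
  by rewrite mule1 lte_fin.
pose E := exponential_pdf b.
(* On the part of the strip with p.2 >= 0 this is |K| exp(-b p.2), written through the exponential
   density so that its total mass 1 gives the integral. *)
pose g (p : R * R) := \1_I p.1 * (`|K| / b * E p.2).
have E0 y : 0 <= E y by apply: exponential_pdf_ge0; exact: ltW.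
have Kb0 : 0 <= `|K| / b by rewrite divr_ge0 // ltW.
have mE : measurable_fun [set: R] E by exact: measurable_exponential_pdf.
have g0 p : 0 <= g p by rewrite mulr_ge0 // mulr_ge0.
apply: (@Rintegral_gt0 _ (measurableTypeR R * measurableTypeR R)%type _ _
  A (I `*` J) f g e) => //.
- exact: measurableX.
- by move=> p [/inI pI]; rewrite /J /= in_itv /= => pJ; exact: A2.
- by move=> p [/inI pI]; rewrite /J /= in_itv /= => pJ; exact: f2.
- move=> p Ap; have [p1 p2] := A1 _ Ap; have /andP[-> /= h] := f1 _ Ap.
  apply: le_trans h _; rewrite /g indicE mem_set ?mul1r; last exact/inI.
  rewrite /E exponential_pdfE // mulrA divfK ?gt_eqF //.
  by rewrite ler_wpM2r ?expR_ge0 // ler_norm.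
rewrite fubini_tonelli1; last 2 first.
- apply/measurable_EFinP; apply: measurable_funM.
    apply: measurableT_comp => //; exact: measurable_indic.
  by apply: measurable_funM => //; exact: measurableT_comp.
- by move=> p; rewrite lee_fin.
rewrite /fubini_F /g /=.
under eq_integral => x _.
  under eq_integral do rewrite mulrA EFinM.
  rewrite ge0_integralZl_EFin //; last 3 first.
  - by move=> y _; rewrite lee_fin.
  - exact/measurable_EFinP.
  - by rewrite mulr_ge0.
  rewrite integral_exponential_pdf // mule1 mulrC EFinM.
  over.
rewrite ge0_integralZl_EFin //; last first.
  by apply/measurable_EFinP; exact: measurable_indic.
by rewrite integral_indic // setIT [X in (_ * X)%E]muI mule1 ltry.
Qed.

(** * Absolute values of exponentials and of terms of convergent series *)

Lemma ratrC (R : realType) (x : rat) : ratr x = (ratr x : R)%:C :> R[i].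
Proof. by rewrite -(fmorph_eq_rat (real_complex R \o ratr)). Qed.

Lemma normcE_Re (R : realType) (z : R[i]) : `|z| = (complex.Re `|z|)%:C.
Proof. by rewrite normc_def. Qed.

Lemma normc_cexp (R : realType) (z : R[i]) : `|cexp z| = (expR (complex.Re z))%:C.
Proof.
rewrite /cexp normrM [X in X * _]normc_def [X in _ * X]normc_def /= cos2Dsin2.
by rewrite sqrtr1 mulr1 expr0n addr0 sqrtr_sqr ger0_norm // expR_ge0.
Qed.

Lemma normc_e2ipi (R : realType) (x : rat) (z : R[i]) :
  `|e2ipi (ratr x * z)| = (expR (- (2 * pi * ratr x * complex.Im z)))%:C.
Proof.
rewrite /e2ipi normc_cexp ratrC; case: z => a b; congr (expR _)%:C => /=.
by simpc; rewrite /=; ring.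
Qed.

Lemma Re_normc_ge0 (R : realType) (z : R[i]) : 0 <= complex.Re `|z|.
Proof. by rewrite normc_def sqrtr_ge0. Qed.

Lemma cvg_normc_le (R : realType) (u : nat -> R[i]) (l : R[i]) (B : R) :
  (u : nat -> (R[i])^o) @ \oo --> (l : (R[i])^o) ->
  (forall n, `|u n| <= B%:C) -> `|l| <= B%:C.
Proof.
move=> ul uB; apply/ler_addgt0Pr => e e0.
move/(@cvgrPdist_lt R[i] (R[i])^o nat \oo _) : ul => /(_ e e0)[N _ uN].
have {}uN : `|l - u N| <= e := ltW (uN N (leqnn N)).
by rewrite -[l](subrK (u N)) addrC; apply: (le_trans (ler_normD _ _)); exact: lerD.
Qed.

Lemma cvg_series_bounded_terms (R : realType) (u : nat -> R[i]) (l : R[i]) :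
  series (u : nat -> (R[i])^o) @ \oo --> (l : (R[i])^o) ->
  exists M : R, forall n, `|u n| <= M%:C.
Proof.
move=> ul; have /cvg_series_cvg_0 u0 : cvgn (series (u : nat -> (R[i])^o)).
  by apply/cvg_ex; exists l.
move/(@cvgr0Pnorm_lt R[i] (R[i])^o nat \oo _) : u0 => /(_ 1 ltr01)[N _ uN].
pose m n : R := complex.Re `|u n|.
have mE n : `|u n| = (m n)%:C by exact: normcE_Re.
have m0 n : 0 <= m n by exact: Re_normc_ge0.
(* From index [N] on the terms are below 1; the sum covers the finitely many earlier ones. *)
exists (1 + \sum_(i < N) m i) => n; rewrite mE lecR.
have [nN|Nn] := ltnP n N.
  rewrite (bigD1 (Ordinal nN)) //= addrCA lerDl addr_ge0 //.
  by rewrite sumr_ge0.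
apply: (@le_trans _ _ 1); last by rewrite lerDl sumr_ge0.
by rewrite -lecR -mE; apply: ltW; exact: uN.
Qed.

Lemma geometric_sum_le (R : realType) (r : R) n :
  0 <= r -> r < 1 -> \sum_(0 <= i < n) r ^+ i <= (1 - r)^-1.
Proof.
move=> r0 r1; have h : 0 < 1 - r by rewrite subr_gt0.
rewrite -(ler_pM2l h) divff ?gt_eqF // big_mkord.
have -> : (1 - r) * \sum_(i < n) r ^+ i = 1 - r ^+ n.
  by rewrite -opprB mulNr -subrX1 opprB.
by rewrite gerBl exprn_ge0.
Qed.

(** * Growth and uniqueness of q-expansions *)

(** The expansion of a single component: exponents run over [q] + j for natural j, and only
    convergence of the partial sums at each point is required. *)
Definition is_qexp (R : realType) (q : rat) (a : nat -> R[i]) (F : uhp R -> R[i]) :=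
  forall t : uhp R,
    series (fun j => a j * e2ipi (ratr (q + j%:R) * \val t) : (R[i])^o) @ \oo
      --> (F t : (R[i])^o).

(** Convergence at one low point already controls all coefficients, which gives a constant uniform
    in the real part of t. *)
Lemma qexp_le (R : realType) (q : rat) (a : nat -> R[i]) (F : uhp R -> R[i])
    (j0 : nat) :
  is_qexp q a F -> (forall j, (j < j0)%N -> a j = 0) ->
  exists K : R, forall t, 1 / 2 <= complex.Im (\val t) ->
    `|F t| <= (K * expR (- (2 * pi * ratr (q + j0%:R) * complex.Im (\val t))))%:C.
Proof.
move=> aF a0; have h4 : 0 < complex.Im (0 +i* (1 / 4) : R[i]) by rewrite /=; lra.
(* The terms are bounded at height 1/4, hence decay geometrically from height 1/2 on. *)
have [M HM] := cvg_series_bounded_terms (aF (Uhp h4)).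
pose m n : R := complex.Re `|a n|.
have mE n : `|a n| = (m n)%:C by exact: normcE_Re.
have m0 n : 0 <= m n by exact: Re_normc_ge0.
set c : R := 2 * pi; have c0 : 0 < c by rewrite mulr_gt0 // pi_gt0.
pose Q : R := ratr q.
have QE j : ratr (q + j%:R) = Q + j%:R :> R by rewrite rmorphD /= ratr_nat.
clearbody Q.
have Mm n : m n <= M * expR (c * (Q + n%:R) / 4).
  move: (HM n); rewrite normrM normc_e2ipi /= mE -rmorphM lecR QE -/c.
  rewrite mulrA mulr1 expRN ler_pdivrMr ?expR_gt0 //.
pose r : R := expR (- (c / 4)).
have r0 : 0 <= r by exact: expR_ge0.
have r1 : r < 1 by rewrite expR_lt1 oppr_lt0 divr_gt0.
have M0 : 0 <= M.
  by have := le_trans (m0 0) (Mm 0); rewrite pmulr_lge0 // expR_gt0.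
(* With this constant, comparing the exponents of the j-th term and of its geometric bound leaves c
   (j - j0) (y - 1/2) >= 0. The summand c j0 / 4 offsets r^j0, so that the geometric series may
   start at 0. *)
pose K1 : R := M * expR (c * (Q + j0%:R) / 4 + c * j0%:R / 4).
have K10 : 0 <= K1 by rewrite mulr_ge0 // expR_ge0.
exists (K1 / (1 - r)) => t ty; set y := complex.Im _ in ty *.
set E := expR _; have E0 : 0 <= E by exact: expR_ge0.
apply: (cvg_normc_le (aF t)) => n; rewrite /series /=.
apply: le_trans (ler_norm_sum _ _ _) _.
have bnd j : `|a j * e2ipi (ratr (q + j%:R) * \val t)| <= (K1 * E * r ^+ j)%:C.
  rewrite normrM normc_e2ipi mE -rmorphM lecR -/y -/c.
  have [/a0 aj0|jj] := ltnP j j0.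
    have -> : m j = 0 by rewrite /m aj0 normr0.
    by rewrite mul0r !mulr_ge0 // exprn_ge0.
  apply: le_trans (ler_wpM2r (expR_ge0 _) (Mm j)) _.
  rewrite /K1 /E /r !QE; move: (c) c0 => d d0.
  rewrite -expRM_natl -!mulrA -!expRD ler_wpM2l // ler_expR.
  have : 0 <= (j%:R - j0%:R) * (y - 1 / 2) * d :> R.
    by rewrite !mulr_ge0 ?subr_ge0 ?ler_nat // ltW.
  rewrite -mulr_natr; nra.
apply: (le_trans (ler_sum _ (fun j _ => bnd j))).
rewrite -rmorph_sum lecR -mulr_sumr [leRHS]mulrAC ler_wpM2l ?mulr_ge0 //.
exact: geometric_sum_le.
Qed.

(** Past index [j0] the two partial sums differ by the constant [w], hence so do the limits. *)
Lemma qexp_remove_term (R : realType) (q : rat) (a : nat -> R[i])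
    (F : uhp R -> R[i]) (j0 : nat) :
  is_qexp q a F ->
  is_qexp q (fun j => if j == j0 then 0 else a j)
    (fun t => F t - a j0 * e2ipi (ratr (q + j0%:R) * \val t)).
Proof.
move=> aF t; set w := a j0 * _; set u := fun j => _.
have -> : series (u : nat -> (R[i])^o) = (fun n : nat =>
    series (fun j => a j * e2ipi (ratr (q + j%:R) * \val t) : (R[i])^o) n
      - (if (j0 < n)%N then w else 0) : (R[i])^o).
  apply/funext => n; rewrite /series /=.
  have -> : (if (j0 < n)%N then w else 0) =
      \sum_(0 <= j < n | j == j0) a j * e2ipi (ratr (q + j%:R) * \val t).
    by rewrite big_nat1_eq.
  rewrite [X in _ - X]big_mkcond /= -sumrB; apply: eq_bigr => j _; rewrite /u.
  by case: eqP => [->|_]; rewrite ?mul0r ?subrr ?subr0.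
apply: cvgB; first exact: aF.
apply/(@cvgrPdist_lt R[i] (R[i])^o nat \oo _) => e e0.
by exists j0.+1 => // n /= jn; rewrite jn subrr normr0.
Qed.

(** Without its leading term, [F] is smaller than that term by a factor of order exp(-2 pi y), so
    high in the cusp it takes away at most half of it. *)
Lemma qexp_ge (R : realType) (q : rat) (a : nat -> R[i]) (F : uhp R -> R[i])
    (j0 : nat) :
  is_qexp q a F -> (forall j, (j < j0)%N -> a j = 0) -> a j0 != 0 ->
  exists2 e : R, 0 < e & exists2 Y : R, 1 <= Y &
    forall t, Y <= complex.Im (\val t) ->
      (e * expR (- (2 * pi * ratr (q + j0%:R) * complex.Im (\val t))))%:C
        <= `|F t|.
Proof.
move=> aF a0 aj0; have aF' := @qexp_remove_term _ _ _ _ j0 aF.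
have [j|K HK] := @qexp_le _ _ _ _ j0.+1 aF'.
  by rewrite ltnS leq_eqVlt; case: eqP => //= _ /a0.
pose m : R := complex.Re `|a j0|.
have mE : `|a j0| = m%:C by exact: normcE_Re.
have m0 : 0 < m by rewrite -ltcR -mE normr_gt0.
set c : R := 2 * pi in HK *; have c0 : 0 < c by rewrite mulr_gt0 // pi_gt0.
have cE : 2 * pi = c by []; clearbody c.
exists (m / 2); first by rewrite divr_gt0.
have KY0 : 0 <= 2 * `|K| / (m * c) by rewrite divr_ge0 // ?mulr_ge0 // ltW.
(* For y beyond this height, |K| <= (m/2) c y <= (m/2) exp(c y), using 1 + x <= exp x. *)
exists (1 + 2 * `|K| / (m * c)); first by rewrite lerDl.
move=> t; set y := complex.Im _ => tY.
have y12 : 1 / 2 <= y by lra.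
have := HK t y12; rewrite -/y.
set w := a j0 * _; have wE : `|w| = (m * expR (- (c * ratr (q + j0%:R) * y)))%:C.
  by rewrite /w normrM mE normc_e2ipi cE -/y -rmorphM.
have -> : expR (- (c * ratr (q + j0.+1%:R) * y)) =
    expR (- (c * ratr (q + j0%:R) * y)) * expR (- (c * y)).
  rewrite -expRD; congr expR; rewrite -[j0.+1]addn1 natrD addrA rmorphD /= rmorph1.
  by ring.
set E := expR _; have E0 : 0 < E by exact: expR_gt0.
move=> h; have -> : F t = w + (F t - w) by rewrite addrC subrK.
apply: le_trans (lerB_normD _ _); rewrite wE lerBrDr.
apply: le_trans (lerD (lexx _) h) _; rewrite -rmorphD lecR.
have : K * expR (- (c * y)) <= m / 2.
  rewrite expRN ler_pdivrMr ?expR_gt0 //.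
  apply: (@le_trans _ _ (m / 2 * (1 + c * y))); last first.
    by rewrite ler_wpM2l ?expR_ge1Dx // ltW // divr_gt0.
  apply: le_trans (ler_norm K) _.
  have : 2 * `|K| <= y * (m * c).
    by rewrite -ler_pdivrMr ?mulr_gt0 //; lra.
  by move: m0 c0 => /=; nra.
by rewrite -/E; move: (expR (- (c * y))) => z; nra.
Qed.

Lemma qexp_lead_ge (R : realType) (q : rat) (a : nat -> R[i]) (F : uhp R -> R[i]) :
  is_qexp q a F -> (exists j, a j != 0) ->
  exists j0, exists2 e : R, 0 < e & exists2 Y : R, 1 <= Y &
    forall t, Y <= complex.Im (\val t) ->
      (e * expR (- (2 * pi * ratr (q + j0%:R) * complex.Im (\val t))))%:C
        <= `|F t|.
Proof.
move=> aF ex; exists (ex_minn ex); case: ex_minnP => n an nmin.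
apply: qexp_ge aF _ an => i ni; apply/eqP.
by apply: contraLR ni => ai; rewrite -leqNgt nmin.
Qed.

(** A nonzero coefficient yields a leading one, whose lower bound contradicts the vanishing of [F]
    at a high point of the imaginary axis. *)
Lemma qexp_eq0 (R : realType) (q : rat) (a : nat -> R[i]) (F : uhp R -> R[i]) :
  is_qexp q a F -> (forall t, F t = 0) <-> (forall j, a j = 0).
Proof.
move=> aF; split=> [F0 j|a0 t].
  apply/eqP/negPn/negP => aj.
  have [|j0 [e e0 [Y Y1 h]]] := qexp_lead_ge aF; first by exists j.
  have Y0 : 0 < complex.Im (0 +i* Y : R[i]) by rewrite /=; lra.
  have := h (Uhp Y0) (lexx Y); rewrite F0 normr0 lecR leNgt.
  by rewrite mulr_gt0 // expR_gt0.
apply/eqP; rewrite -normr_le0; apply: (cvg_normc_le (aF t)) => n.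
by rewrite /series /= big1 ?normr0 // => j _; rewrite a0 mul0r.
Qed.

Lemma qexpD (R : realType) (q : rat) (a b : nat -> R[i]) (F G : uhp R -> R[i]) :
  is_qexp q a F -> is_qexp q b G ->
  is_qexp q (fun j => a j + b j) (fun t => F t + G t).
Proof.
move=> aF bG t; set u := fun j => _.
have -> : series (u : nat -> (R[i])^o) = (fun n : nat =>
    series (fun j => a j * e2ipi (ratr (q + j%:R) * \val t) : (R[i])^o) n +
    series (fun j => b j * e2ipi (ratr (q + j%:R) * \val t) : (R[i])^o) n
    : (R[i])^o).
  apply/funext => n; rewrite /series /= -big_split /=; apply: eq_bigr => j _.
  by rewrite /u mulrDl.
by apply: cvgD; [exact: aF|exact: bG].
Qed.

(** * The character e(x) and its kernel *)

Lemma cexpD (R : realType) (z w : R[i]) : cexp (z + w) = cexp z * cexp w.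
Proof.
case: z w => [a b] [c d]; rewrite /cexp /= expRD cosD sinD !rmorphM /=.
rewrite mulrACA; congr (_ * _); simpc; congr (_ +i* _); ring.
Qed.

Lemma e2ipiD (R : realType) (z w : R[i]) : e2ipi (z + w) = e2ipi z * e2ipi w.
Proof. by rewrite /e2ipi mulrDr cexpD. Qed.

Lemma e2ipi_real (R : realType) (x : R) :
  e2ipi x%:C = cos (2 * pi * x) +i* sin (2 * pi * x).
Proof.
rewrite /e2ipi /cexp; have -> : 2 * pi%:C * 'i%C * x%:C = 0 +i* (2 * pi * x) :> R[i].
  by simpc; congr (_ +i* _); ring.
by rewrite /= expR0 mul1r.
Qed.

Lemma e2ipi0 (R : realType) : e2ipi 0 = 1 :> R[i].
Proof. by rewrite (e2ipi_real 0) mulr0 cos0 sin0. Qed.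

Lemma e2ipi_nat (R : realType) (n : nat) : e2ipi n%:R = 1 :> R[i].
Proof.
elim: n => [|n IH]; first exact: e2ipi0.
rewrite -addn1 natrD e2ipiD IH mul1r (e2ipi_real 1) mulr1 mulr_natl cos2pi sin2pi.
by [].
Qed.

Lemma e2ipiN (R : realType) (z : R[i]) : e2ipi (- z) = (e2ipi z)^-1.
Proof.
have h : e2ipi z * e2ipi (- z) = 1 by rewrite -e2ipiD subrr e2ipi0.
have z0 : e2ipi z != 0 by apply: contra_eq_neq h => ->; rewrite mul0r eq_sym oner_eq0.
by apply: (mulfI z0); rewrite h divff.
Qed.

Lemma e2ipi_int (R : realType) (x : rat) :
  x \is a Num.int -> e2ipi (ratr x) = 1 :> R[i].
Proof.
move=> /intrP[[n|n] ->]; rewrite ratr_int; first exact: e2ipi_nat.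
by rewrite NegzE rmorphN /= e2ipiN e2ipi_nat invr1.
Qed.

(** For the fractional part y, cos(2 pi y) = 1 - 2 sin(pi y)^2, and the sine is positive when 0 < y
    < 1. *)
Lemma e2ipi_eq1 (R : realType) (x : rat) :
  e2ipi (ratr x) = 1 :> R[i] -> x \is a Num.int.
Proof.
pose y := x - (Num.floor x)%:~R.
have /andP[y0 y1] : 0 <= y < 1.
  by have := floor_itv x; rewrite /y intrD; lra.
have fi : (Num.floor x)%:~R \is a @Num.int rat by exact: Num.Theory.intr_int.
have -> : x = y + (Num.floor x)%:~R by rewrite /y subrK.
rewrite rmorphD /= e2ipiD (e2ipi_int _ fi) mulr1 ratrC e2ipi_real => -[cos1 _].
rewrite rpredD //; move: y0; rewrite le_eqVlt => /predU1P[<-|y0]; first exact: rpred0.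
have : 0 < sin (pi * ratr y : R).
  apply: sin_gt0_pi; rewrite mulr_gt0 ?pi_gt0 ?ltr0q //=.
  by rewrite gtr_pMr ?pi_gt0 // -[1](rmorph1 (ratr : rat -> R)) ltr_rat.
move: cos1; have -> : 2 * pi * ratr y = (pi * ratr y) *+ 2 :> R by rewrite mulr2n; ring.
rewrite cos_mulr2n cos2sin2; set s := sin _ => h1 s0.
have : 0 < s ^+ 2 by rewrite exprn_gt0.
by move: h1; rewrite mulr2n; lra.
Qed.

Lemma e2ipi_frac1 (R : realType) (x : rat) :
  e2ipi (ratr (frac1 x)) = e2ipi (ratr x) :> R[i].
Proof.
have fi : (Num.floor x)%:~R \is a @Num.int rat by exact: Num.Theory.intr_int.
by rewrite /frac1 rmorphB /= e2ipiD e2ipiN (e2ipi_int _ fi) invr1 mulr1.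
Qed.

(** * Characters of the discriminant group *)

Section Discriminant.
Local Open Scope quotient_scope.
Variables (R : realType) (n : nat) (L : evenLattice n).
Local Notation D := (disc L).
Implicit Types g d : D.

(** Up to the scalar factor, these are the matrix entries of [rho (mpS R)]. *)
Definition disc_char g d : R[i] := e2ipi (- ratr (discb g d)).

Lemma disc_char_pi (u v : dual_lattice L) :
  disc_char (\pi_(disc L) u) (\pi_(disc L) v) =
    e2ipi (- ratr (bil L (\val u) (\val v))).
Proof. by rewrite /disc_char discb_pi !e2ipiN e2ipi_frac1. Qed.

Lemma disc_ind (P : D -> Prop) : (forall u, P (\pi_(disc L) u)) -> forall g, P g.
Proof. by move=> h g; rewrite -[g]reprK. Qed.

Lemma disc_charDr g d d' : disc_char g (d + d') = disc_char g d * disc_char g d'.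
Proof.
elim/disc_ind: g => u; elim/disc_ind: d => v; elim/disc_ind: d' => w.
rewrite -raddfD !disc_char_pi -e2ipiD -opprD -rmorphD; congr (e2ipi (- ratr _)).
by rewrite !(bilC _ (\val u)) bilDl.
Qed.

Lemma disc_charC g d : disc_char g d = disc_char d g.
Proof. by elim/disc_ind: g => u; elim/disc_ind: d => v; rewrite !disc_char_pi bilC. Qed.

Lemma disc_charDl g g' d : disc_char (g + g') d = disc_char g d * disc_char g' d.
Proof. by rewrite !(disc_charC _ d) disc_charDr. Qed.

Lemma discqN g : discq (- g) = discq g.
Proof.
elim/disc_ind: g => u; rewrite -raddfN !discq_pi; congr (frac1 (_ / 2)).
by rewrite bilNl bilC bilNl opprK.
Qed.

(** Pairing with the dual basis reads off the coordinates of a representative, so a trivial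
    character forces all of them to be integers. *)
Lemma disc_char_nondeg g : (forall d, disc_char g d = 1) -> g = 0.
Proof.
elim/disc_ind: g => u h; rewrite -(raddf0 \pi_(disc L)); apply/eqP.
rewrite discE subr0; apply/mxOverP => i j; rewrite {i}ord1.
pose G : 'M[rat]_n := map_mx intr (gram L).
have G_unit : G \in unitmx.
  by rewrite unitmxE det_map_mx unitfE intr_eq0 gram_nondeg.
have trG : G^T = G by rewrite map_trmx gram_sym.
(* Row j of the inverse Gram matrix, that is, the j-th vector of the dual basis. *)
pose v : 'rV[rat]_n := delta_mx 0 j *m invmx G.
have bv x : bil L x v = x 0 j.
  rewrite /bil -/G /v trmx_mul trmx_inv trG trmx_delta -mulmxA mulKVmx //.
  by rewrite -colE mxE.
have vd : v \in in_dual L.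
  by apply/asboolP => y /mxOverP yL; rewrite bilC bv.
have := h (\pi_(disc L) (Dual vd)); rewrite disc_char_pi bv -rmorphN.
by move/e2ipi_eq1; rewrite rpredN.
Qed.

(** Orthogonality: translating the sum by some [d0] with nontrivial character value multiplies it by
    that value. *)
Lemma disc_char_sum g : \sum_d disc_char g d = (#|{: D}|)%:R *+ (g == 0).
Proof.
have [->|g0] := eqVneq g 0.
  have c0 d : disc_char 0 d = 1.
    have : disc_char (0 + 0) d = disc_char 0 d * disc_char 0 d by exact: disc_charDl.
    have z0 : disc_char 0 d != 0.
      have : disc_char 0 d * e2ipi (ratr (discb 0 d)) = 1.
        by rewrite /disc_char -e2ipiD addNr e2ipi0.
      by apply: contra_eq_neq => ->; rewrite mul0r eq_sym oner_eq0.
    by rewrite addr0 -[LHS]mulr1 => /(mulfI z0).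
  by under eq_bigr do rewrite c0; rewrite sumr_const.
have [d0 hd0] : exists d0, disc_char g d0 != 1.
  apply/not_existsP => h; move/eqP: g0; apply; apply: disc_char_nondeg => d.
  by apply/eqP/negPn/negP; exact: h.
have hS : \sum_d disc_char g d = disc_char g d0 * \sum_d disc_char g d.
  rewrite mulr_sumr (reindex_inj (addrI d0)) /=.
  by apply: eq_bigr => d _; rewrite disc_charDr.
apply/eqP; rewrite mulr0n.
have : (1 - disc_char g d0) * \sum_d disc_char g d = 0.
  by rewrite mulrBl mul1r -hS subrr.
by move/eqP; rewrite mulf_eq0 subr_eq0 eq_sym (negbTE hd0).
Qed.

End Discriminant.

(** * The action of the square of S and antisymmetry of cusp forms *)

Lemma sqrtc_Im_ge0 (R : realType) (t : uhp R) : 0 <= complex.Im (sqrtc (\val t)).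
Proof.
by case: t => [[a b] /= b0]; rewrite (gt_eqF b0) gtr0_sg // mul1r sqrtr_ge0.
Qed.

Lemma mobiusSS (R : realType) (t : uhp R) :
  mobius (mp_mx (mpS R)) (mobius (mp_mx (mpS R)) t) = t.
Proof.
apply: val_inj; rewrite /= /mobnum /mobden /= /mobnum /mobden !mxE /=.
have t0 : \val t != 0 :> R[i].
  by have := mobden_neq0 (mp_mx (mpS R)) t; rewrite /mobden !mxE /= mul1r addr0.
by field.
Qed.

(** The square of the product is (-1/t) t = -1. Both principal roots lie in the closed first
    quadrant, so the product has nonnegative imaginary part, which excludes -i. *)
Lemma sqrtc_mobiusS (R : realType) (t : uhp R) :
  sqrtc (\val (mobius (mp_mx (mpS R)) t)) * sqrtc (\val t) = 'i%C.
Proof.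
set u := mobius _ t; set z := _ * _.
have t0 : \val t != 0 :> R[i].
  by have := mobden_neq0 (mp_mx (mpS R)) t; rewrite /mobden !mxE /= mul1r addr0.
have : z ^+ 2 = 'i%C ^+ 2.
  rewrite exprMn !sqr_sqrtc sqr_i /u /= /mobnum /mobden !mxE /=.
  by field.
move/eqP; rewrite eqf_sqr => /orP[/eqP //|/eqP zi].
have : 0 <= complex.Im z.
  rewrite /z; have := sqrtc_Im_ge0 t; have := sqrtc_Im_ge0 u.
  have := sqrtc_Re_gt0 t; have := sqrtc_Re_gt0 u.
  case: (sqrtc _) => a b; case: (sqrtc _) => c d /= a0 c0 b0 d0.
  by rewrite addr_ge0 // mulr_ge0 // ltW.
by rewrite zi /= lerNr oppr0 leNgt ltr01.
Qed.

(* [discC] is a finite function space behind several structures: rewriting with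
   [ffunE] itself is prohibitively slow there, hence these specializations. *)
Lemma disc_basisE (R : realType) (n : nat) (L : evenLattice n) (g d : disc L) :
  disc_basis R g d = (d == g)%:R.
Proof. exact: ffunE. Qed.

Lemma discC_scaleE (R : realType) (n : nat) (L : evenLattice n) (a : R[i])
    (v : discC R L) (d : disc L) : (a *: v) d = a * (v d : R[i]).
Proof. exact: ffunE. Qed.

Lemma discC_zeroE (R : realType) (n : nat) (L : evenLattice n) (d : disc L) :
  (0 : discC R L) d = 0.
Proof. exact: ffunE. Qed.

Lemma discC_sumE (R : realType) (n : nat) (L : evenLattice n) (I : finType)
    (F : I -> discC R L) (d : disc L) : (\sum_i F i) d = \sum_i (F i d : R[i]).
Proof. exact: sum_ffunE. Qed.

Lemma discC_combE (R : realType) (n : nat) (L : evenLattice n)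
    (F : disc L -> R[i]) (d : disc L) : (\sum_g F g *: disc_basis R g) d = F d.
Proof.
have e g : (F g *: disc_basis R g) d = F g * (d == g)%:R.
  by rewrite -disc_basisE; exact: discC_scaleE.
rewrite discC_sumE (eq_bigr _ (fun g _ => e g)) (bigD1 d) //= eqxx mulr1.
by rewrite big1 ?addr0 // => g gd; rewrite eq_sym (negbTE gd) mulr0.
Qed.

Lemma discC_basis (R : realType) (n : nat) (L : evenLattice n) (v : discC R L) :
  v = \sum_g v g *: disc_basis R g.
Proof. by apply/ffunP => d; exact/esym/discC_combE. Qed.

Lemma weil_S (R : realType) (n : nat) (L : evenLattice n)
    (rho : Mp2 R -> 'End(discC R L)) (v : discC R L) (d : disc L) :
  is_weil_representation rho ->
  rho (mpS R) v d = e2ipi (- (1 / 8)) / (Num.sqrt (#|{: disc L}|%:R : R))%:C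
    * \sum_g (v g : R[i]) * disc_char R g d.
Proof.
case=> _ _ _ rhoS; rewrite {1}[v]discC_basis linear_sum discC_sumE mulr_sumr.
apply: eq_bigr => g _; rewrite linearZ /= rhoS.
transitivity ((v g : R[i]) * (e2ipi (- (1 / 8)) /
    (Num.sqrt (#|{: disc L}|%:R : R))%:C * disc_char R g d)); last first.
  exact: mulrCA.
transitivity ((v g : R[i]) *
    ((e2ipi (- (1 / 8)) / (Num.sqrt (#|{: disc L}|%:R : R))%:C) *:
      \sum_d0 disc_char R g d0 *: disc_basis R d0 : discC R L) d).
  exact: discC_scaleE.
by congr (_ * _); rewrite discC_scaleE discC_combE.
Qed.

(** Exchanging the two sums leaves a sum of the character of g0 + d, which singles out g0 = - d with
    weight |D|. *)
Lemma weil_SS (R : realType) (n : nat) (L : evenLattice n)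
    (rho : Mp2 R -> 'End(discC R L)) (v : discC R L) (d : disc L) :
  is_weil_representation rho ->
  rho (mpS R) (rho (mpS R) v) d = - 'i%C * (v (- d) : R[i]).
Proof.
move=> W; rewrite weil_S //; under eq_bigr => g _ do rewrite weil_S //.
(* The cardinality cancels both square roots, and e(-1/8)^2 = e(-1/4) = -i. *)
set c := e2ipi _ / _; have cc : c * (c * (#|{: disc L}|)%:R) = - 'i%C.
  have D0 : (0 : R) < (#|{: disc L}|)%:R by rewrite ltr0n; apply/card_gt0P; exists 0.
  rewrite /c; set s := (Num.sqrt _)%:C.
  have s2 : s * s = (#|{: disc L}|)%:R.
    by rewrite -rmorphM -expr2 sqr_sqrtr ?ltW // rmorph_nat.
  have s0 : s != 0 by rewrite -sqrf_eq0 expr2 s2 pnatr_eq0 -lt0n -(ltr0n R).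
  rewrite -s2; transitivity (e2ipi (- (1 / 8)) * e2ipi (- (1 / 8)) : R[i]).
    by move: (e2ipi _) => e; field.
  rewrite -e2ipiD; have -> : - (1 / 8) + - (1 / 8) = (- (1 / 4))%:C :> R[i].
    by rewrite rmorphN rmorphM rmorph1 fmorphV rmorph_nat; field.
  rewrite e2ipi_real; have -> : 2 * pi * - (1 / 4) = - (pi / 2) :> R by field.
  by rewrite cosN sinN cos_pihalf sin_pihalf; simpc.
clearbody c.
have -> : \sum_g (c * \sum_g0 (v g0 : R[i]) * disc_char R g0 g) * disc_char R g d
    = c * ((#|{: disc L}|)%:R * (v (- d) : R[i])).
  under eq_bigr do rewrite -mulrA mulr_suml.
  rewrite -mulr_sumr exchange_big /=; congr (_ * _).
  under eq_bigr => g _.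
    under eq_bigr do rewrite -mulrA [disc_char R _ d]disc_charC -disc_charDl.
    rewrite -mulr_sumr disc_char_sum addr_eq0; over.
  rewrite (bigD1 (- d)) //= eqxx mulr1n mulrC big1 ?addr0 // => g gd.
  by rewrite (negbTE gd) mulr0n mulr0.
by rewrite -cc !mulrA.
Qed.

(** Turns the integer exponent of the automorphy factor into a natural number congruent to 3 mod
    4. *)
Lemma weight_numq (k : rat) (j : nat) :
  k = 3 / 2 + 2 * j%:R -> numq (2 * k) = (3 + j * 4)%N.
Proof.
move=> ->; have -> : 2 * (3 / 2 + 2 * j%:R) = (3 + j * 4)%N%:Z%:~R :> rat.
  by rewrite -pmulrn natrD natrM; field.
by rewrite numq_int.
Qed.

Lemma cusp_form_antisym (R : realType) (n : nat) (L : evenLattice n)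
    (rho : Mp2 R -> 'End(discC R L)) (k : rat) (h : uhp R -> discC R L) :
  is_weil_representation rho -> (exists j : nat, k = 3 / 2 + 2 * j%:R) ->
  cusp_forms rho k h -> forall t g, (h t (- g) : R[i]) = - (h t g : R[i]).
Proof.
move=> W [j /weight_numq kE] [_ hS _] t g.
(* Modularity under S is used at S t and again at t; the two automorphy factors multiply to a power
   of i, and coordinate [- g] of the result involves h_g. *)
have := congr1 (fun v : discC R L => v (- g) : R[i])
  (hS (mpS R) (mobius (mp_mx (mpS R)) t)).
rewrite mobiusSS hS linearZ /= scalerA kE -exprMn sqrtc_mobiusS.
rewrite discC_scaleE weil_SS // opprK => ->.
have -> : 'i%C ^+ (3 + j * 4) = - 'i%C :> R[i].
  rewrite exprD mulnC (exprM _ 4 j) (exprM _ 2 2) sqr_i sqrrN !expr1n mulr1.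
  by rewrite exprS sqr_i mulrN1.
by rewrite -[LHS]/(_ * _) mulrA mulrNN -expr2 sqr_i mulN1r.
Qed.

(** * Fourier expansions of cusp forms *)

Lemma discq_itv (n : nat) (L : evenLattice n) (g : disc L) : 0 <= discq g < 1.
Proof.
rewrite /discq /frac1; set x : rat := _ / _.
by have := floor_itv x; rewrite intrD; lra.
Qed.

Section CuspFormExpansion.
Variables (R : realType) (n : nat) (L : evenLattice n).
Implicit Types (h : uhp R -> discC R L) (c : disc L -> rat -> R[i]).

Lemma fourier_qexp h c g : is_fourier h c ->
  is_qexp (discq g) (fun j => c g (discq g + j%:R)) (fun t => h t g : R[i]).
Proof. by case=> _ hc t; exact: hc. Qed.

(** A cusp form has some Fourier family, so the choice made by [fourier_coef] does not fall back on
    its default. *)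
Lemma fourier_coefP (rho : Mp2 R -> 'End(discC R L)) k h :
  cusp_forms rho k h -> is_fourier h (fourier_coef h).
Proof. by case=> _ _ [c hc]; rewrite /fourier_coef; case: xgetP => // /(_ c). Qed.

(** As m > 0 and [discq g] < 1, the integer m - [discq g] exceeds -1. Coefficients are thus indexed
    by naturals as in [is_qexp]. *)
Lemma fourier_supp h c g m : is_fourier h c -> c g m != 0 ->
  exists j : nat, m = discq g + j%:R.
Proof.
case=> supp _ /supp [m0 /intrP[z zE]].
have /andP[q0 q1] := discq_itv g.
have : (-1)%:~R < z%:~R :> rat by rewrite -zE; lra.
rewrite ltr_int; case: z zE => // j zE _; exists j.
by rewrite -[j%:R]/(Posz j)%:~R -zE addrC subrK.
Qed.

(** Since q(-g) = q(g), the expansions of the components at g and -g have the same exponents and add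
    up to one of 0. Off these exponents both coefficients vanish. *)
Lemma fourier_antisym h c : (forall t g, (h t (- g) : R[i]) = - (h t g : R[i])) ->
  is_fourier h c -> forall g m, c (- g) m = - c g m.
Proof.
move=> hN hc g m; apply/eqP; rewrite -addr_eq0; apply/eqP.
have e1 := fourier_qexp (g := g) hc; have e2 := fourier_qexp (g := - g) hc.
rewrite discqN in e2.
have /(qexp_eq0 (qexpD e2 e1)) c0 : forall t, (h t (- g) : R[i]) + (h t g : R[i]) = 0.
  by move=> t; rewrite hN addNr.
have [[j ->]|nj] := pselect (exists j : nat, m = discq g + j%:R); first exact: c0.
have z1 : c g m = 0 by apply/eqP/negPn/negP => /(fourier_supp hc).
have z2 : c (- g) m = 0.
  by apply/eqP/negPn/negP => /(fourier_supp hc); rewrite discqN.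
by rewrite z1 z2 addr0.
Qed.

Lemma cusp_form0 (rho : Mp2 R -> 'End(discC R L)) k :
  cusp_forms rho k (fun=> 0 : discC R L).
Proof.
split=> [g|a t|].
- have -> : (fun _ : uhp R => (0 : discC R L) g : R[i]) = fun=> 0.
    by apply/funext => t; rewrite discC_zeroE.
  exact: holomorphic_cst.
- by rewrite linear0 scaler0.
exists (fun _ _ => 0); split=> [g m|g t]; first by rewrite eqxx.
rewrite discC_zeroE; set u := fun j => _.
have -> : series (u : nat -> (R[i])^o) = fun=> 0.
  by apply/funext => j; rewrite /series /= big1 // => i _; rewrite /u mul0r.
exact: cvg_cst.
Qed.

Lemma cusp_form_decay (rho : Mp2 R -> 'End(discC R L)) k h :
  cusp_forms rho k h ->
  exists2 b : R, 0 < b & exists K : R, forall g t, 1 / 2 <= complex.Im (\val t) ->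
    `|h t g : R[i]| <= (K * expR (- (b * complex.Im (\val t))))%:C.
Proof.
move=> /fourier_coefP; set c := fourier_coef h => hc.
have /choice[xK HxK] : forall g, exists xK : R * R, 0 < xK.1 /\
    forall t, 1 / 2 <= complex.Im (\val t) ->
    `|h t g : R[i]| <= (xK.2 * expR (- (xK.1 * complex.Im (\val t))))%:C.
  move=> g; have e := fourier_qexp (g := g) hc; have /andP[q0 _] := discq_itv g.
  (* The first exponent is positive: take j0 = 0 if q(g) > 0, and j0 = 1 if q(g) = 0, where
     cuspidality kills the constant term. *)
  have [j0 [a0 x0]] : exists j0 : nat,
      (forall j, (j < j0)%N -> c g (discq g + j%:R) = 0) /\ 0 < discq g + j0%:R.
    move: q0; rewrite le_eqVlt => /predU1P[q0|q0]; last first.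
      by exists 0; split=> //; rewrite addr0.
    exists 1; split; last by rewrite -q0.
    move=> [|//] _; apply/eqP/negPn/negP => /(proj1 hc) [].
    by rewrite -q0 addr0 ltxx.
  have [K HK] := qexp_le e a0.
  exists (2 * pi * ratr (discq g + j0%:R), K); split=> //=.
  by rewrite mulr_gt0 ?ltr0q // mulr_gt0 // pi_gt0.
have x0 g : 0 < (xK g).1 by case: (HxK g).
(* The inverse of [B] is a positive rate below the decay rates of all components. *)
pose B : R := 1 + \sum_g ((xK g).1)^-1.
have B0 : 0 < B by rewrite ltr_wpDr // sumr_ge0 // => g _; rewrite invr_ge0 ltW.
have Bx g : B^-1 <= (xK g).1.
  rewrite invf_ple ?posrE // /B (bigD1 g) //= addrCA lerDl addr_ge0 //.
  by rewrite sumr_ge0 // => g' _; rewrite invr_ge0 ltW.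
exists B^-1; first by rewrite invr_gt0.
exists (\sum_g `|(xK g).2|) => g t ty; apply: (le_trans ((HxK g).2 t ty)).
rewrite lecR; apply: (@le_trans _ _
  (`|(xK g).2| * expR (- ((xK g).1 * complex.Im (\val t))))).
  by rewrite ler_wpM2r ?expR_ge0 // ler_norm.
rewrite ler_pM ?expR_ge0 //.
  by rewrite (bigD1 g) //= lerDl sumr_ge0.
by rewrite ler_expR lerN2 ler_wpM2r //; lra.
Qed.

(** Some component has a leading term; on a band of bounded height its exponential is at least its
    value at the top, which makes the bound constant. *)
Lemma cusp_form_lower (rho : Mp2 R -> 'End(discC R L)) k h :
  cusp_forms rho k h -> h <> (fun=> 0) ->
  exists g, exists2 e : R, 0 < e & exists2 Y : R, 1 <= Y &
    forall t, Y <= complex.Im (\val t) <= Y + 1 -> e%:C <= `|h t g : R[i]|.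
Proof.
move=> /fourier_coefP hc h0.
have [g hg] : exists g, ~ forall t, (h t g : R[i]) = 0.
  apply/existsNP => hz; apply: h0; apply/funext => t; apply/ffunP => g.
  by rewrite hz discC_zeroE.
have ex : exists j : nat, fourier_coef h g (discq g + j%:R) != 0.
  apply: contrapT => nex; apply: hg; apply/(qexp_eq0 (fourier_qexp (g := g) hc)) => j.
  by apply/eqP/negPn/negP => cj; apply: nex; exists j.
have [j0 [e e0 [Y Y1 he]]] := qexp_lead_ge (fourier_qexp (g := g) hc) ex.
exists g; set X : R := 2 * pi * ratr (discq g + j0%:R) in he.
have X0 : 0 <= X.
  have /andP[q0 _] := discq_itv g.
  apply: mulr_ge0; first by rewrite mulr_ge0 // pi_ge0.
  by rewrite ler0q addr_ge0.
exists (e * expR (- (X * (Y + 1)))); first by rewrite mulr_gt0 // expR_gt0.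
exists Y => // t /andP[t1 t2]; apply: le_trans (he t t1); rewrite lecR.
by rewrite ler_wpM2l ?(ltW e0) // ler_expR lerN2 ler_wpM2l.
Qed.

End CuspFormExpansion.

(** * Positivity of the Petersson norm *)

Lemma ln_le_subr1 (R : realType) (y : R) : 0 < y -> ln y <= y - 1.
Proof.
move=> y0; have := @le_ln1Dx R (y - 1); have -> : 1 + (y - 1) = y by ring.
by apply; lra.
Qed.

Lemma powR_le_expR (R : realType) (s b : R) : 0 < b ->
  exists2 K : R, 0 <= K & forall y, 1 / 2 <= y -> y `^ s <= K * expR (b * y).
Proof.
move=> b0; have [s0|s0] := leP 0 s.
  have s1 : 0 < s + 1 by lra.
  have d0 : 0 < b / (s + 1) by exact: divr_gt0.
  (* With d = b / (s + 1), ln(d y) <= d y - 1 gives s ln y <= s d y - s (1 + ln d), and s d <= b.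
     Dividing by s + 1 rather than s covers s = 0. *)
  exists (expR (- (s * (1 + ln (b / (s + 1)))))); first exact: expR_ge0.
  move=> y y12; have y0 : 0 < y by lra.
  rewrite /powR gt_eqF // -expRD ler_expR.
  have := ln_le_subr1 (mulr_gt0 d0 y0); rewrite (@lnM R _ y) ?posrE // => h.
  have sd : s * (b / (s + 1)) <= b.
    by rewrite mulrA ler_pdivrMr //; nra.
  by move: (b / (s + 1)) (ln _) h sd d0 => d l h sd d0; nra.
(* For s < 0 the power decreases in y, so its value at 1/2 bounds it. *)
exists (expR (s * ln (1 / 2))); first exact: expR_ge0.
move=> y y12; have y0 : 0 < y by lra.
rewrite /powR gt_eqF // -expRD ler_expR.
have : ln (1 / 2) <= ln y by rewrite ler_ln // posrE; lra.
by move: (ln _) (ln _) => l l'; nra.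
Qed.

(** Here s ln y >= - ln y >= - y. It bounds the weight factor y^(k-2) from below. *)
Lemma expRN_le_powR (R : realType) (s y : R) : -1 <= s -> 1 <= y ->
  expR (- y) <= y `^ s.
Proof.
move=> s1 y1; have y0 : 0 < y by lra.
rewrite /powR gt_eqF // ler_expR.
have := ln_ge0 y1; have := ln_le_subr1 y0; move: (ln _) => l; nra.
Qed.

Lemma petersson_pos (R : realType) (n : nat) (L : evenLattice n)
    (rho : Mp2 R -> 'End(discC R L)) (k : rat) (h : uhp R -> discC R L) :
  1 <= k -> cusp_forms rho k h -> h <> (fun=> 0) ->
  0 < complex.Re (petersson k h h).
Proof.
move=> k1 hk h0; rewrite /petersson /Cintegral /=.
have [b b0 [K HK]] := cusp_form_decay hk.
have [g [e e0 [Y Y1 He]]] := cusp_form_lower hk h0.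
pose s : R := ratr k - 2.
have s1 : -1 <= s.
  by rewrite /s lerBrDr; have := ler_rat R 1 k; rewrite rmorph1 k1 => /idP; lra.
pose S t : R := \sum_g (complex.Re `|h t g : R[i]|) ^+ 2.
pose f (p : R * R) := complex.Re (uhp_ext (fun t => \sum_g (h t g : R[i]) *
   ((h t g : R[i])^*)) (p.1 +i* p.2) * (p.2 `^ s)%:C).
have fE p (p0 : 0 < p.2) : f p = S (@Uhp R (p.1 +i* p.2) p0) * p.2 `^ s.
  rewrite /f -[p.1 +i* p.2]/(\val (@Uhp R (p.1 +i* p.2) p0)) uhp_extE.
  set t := Uhp _; have -> : \sum_g (h t g : R[i]) * (h t g : R[i])^* = (S t)%:C.
    rewrite /S rmorph_sum; apply: eq_bigr => g' _.
    by rewrite -sqr_normc {1}normcE_Re -rmorphXn.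
  by rewrite -rmorphM.
have S0 t : 0 <= S t by apply: sumr_ge0 => g' _; rewrite sqr_ge0.
(* If y < 1/2 then x^2 + y^2 < 1/4 + y/2 < 1/2, against x^2 + y^2 >= 1. *)
have Aprop p : @fund_domain R p -> 0 < p.2 /\ 1 / 2 <= p.2.
  case=> /ler_normlP[p1 p1'] p2 p12; split=> //.
  rewrite leNgt; apply/negP => h2.
  have q1 : 0 <= (1 / 2 - p.1) * (1 / 2 + p.1) by rewrite mulr_ge0; lra.
  have q2 : 0 < p.2 * (1 / 2 - p.2) by rewrite mulr_gt0 //; lra.
  by move: p12; rewrite !expr2; lra.
(* The squared components decay like exp(-2 b y); one factor exp(-b y) absorbs the weight factor,
   the other remains for integrability. *)
have [K2 K20 HK2] := powR_le_expR s b0.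
apply: (@Rintegral_strip_gt0 _ (@fund_domain R) f b
  ((#|{: disc L}|)%:R * K ^+ 2 * K2) (e ^+ 2 * expR (- (Y + 1))) Y) => //.
- by rewrite mulr_gt0 ?expR_gt0 // exprn_gt0.
- by move=> p [p1 p2 _]; split=> //; exact: ltW.
- move=> p p1 /andP[p2 _]; split=> //; first by lra.
  by have := sqr_ge0 p.1; nra.
- move=> p /Aprop[p0 p12]; rewrite fE mulr_ge0 ?powR_ge0 //=.
  set t := Uhp _.
  have St : S t <= (#|{: disc L}|)%:R * (K * expR (- (b * p.2))) ^+ 2.
    rewrite mulr_natl -sumr_const; apply: ler_sum => g' _.
    have Kg : complex.Re `|h t g' : R[i]| <= K * expR (- (b * p.2)).
      by rewrite -lecR -normcE_Re; exact: HK.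
    by rewrite ler_pXn2r ?nnegrE ?Re_normc_ge0 // (le_trans (Re_normc_ge0 _) Kg).
  apply: (@le_trans _ _ ((#|{: disc L}|)%:R * (K * expR (- (b * p.2))) ^+ 2 *
      (K2 * expR (b * p.2)))).
    by apply: ler_pM => //; [exact: powR_ge0|exact: HK2].
  have -> : (K * expR (- (b * p.2))) ^+ 2 =
      K ^+ 2 * expR (- b * p.2) * expR (- (b * p.2)).
    by rewrite exprMn (expr2 (expR _)) mulrA mulNr.
  have -> : (#|{: disc L}|)%:R * (K ^+ 2 * expR (- b * p.2) * expR (- (b * p.2))) *
      (K2 * expR (b * p.2)) = (#|{: disc L}|)%:R * K ^+ 2 * K2 * expR (- b * p.2) *
      (expR (- (b * p.2)) * expR (b * p.2)) by ring.
  by rewrite -expRD addNr expR0 mulr1.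
- move=> p p1 /andP[p2 p2']; have p0 : 0 < p.2 by lra.
  rewrite fE; apply: ler_pM; rewrite ?expR_ge0 ?sqr_ge0 //.
    rewrite /S (bigD1 g) //=; apply: ler_wpDr.
      by apply: sumr_ge0 => g' _; rewrite sqr_ge0.
    have eg : e <= complex.Re `|h (@Uhp R (p.1 +i* p.2) p0) g : R[i]|.
      by rewrite -lecR -normcE_Re; apply: He => /=; rewrite p2.
    by rewrite ler_pXn2r ?nnegrE ?Re_normc_ge0 // ltW.
  apply: le_trans (expRN_le_powR s1 _); last by lra.
  by rewrite ler_expR; lra.
Qed.

Lemma petersson0r (R : realType) (n : nat) (L : evenLattice n) (k : rat)
    (h : uhp R -> discC R L) : petersson k h (fun=> 0 : discC R L) = 0.
Proof.
rewrite /petersson; set f := fun p => _; have -> : f = fun=> 0.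
  apply/funext => p; rewrite /f /uhp_ext; case: insub => [t|]; last by rewrite mul0r.
  rewrite big1 ?mul0r // => g _.
  have -> : ((0 : discC R L) g : R[i]) = 0 by exact: discC_zeroE.
  by rewrite conjC0 mulr0.
by rewrite /Cintegral /Rintegral /= integral0_eq.
Qed.

(** * Invariants, the functional and the shadow *)

Lemma disc_permuteE (R : realType) (n : nat) (L : evenLattice n)
    (s : {perm disc L}) (v : discC R L) (g : disc L) :
  disc_permute s v (s g) = v g.
Proof.
rewrite /disc_permute (reindex_inj (@perm_inj _ s^-1)) /=.
under eq_bigr do rewrite permKV.
by rewrite discC_combE permK.
Qed.

Local Close Scope complex_scope.

Theorem corollary4p2 (R : realType) (n : nat) (L : evenLattice n)
    (sigL : has_signature R L 2 1)
    (rho : Mp2 R -> 'End(discC R L)) (rhoL : is_weil_representation rho)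
    (k : rat) (hk : exists j : nat, k = 3 / 2 + 2 * j%:R) :
  [/\ forall h : uhp R -> discC R L, cusp_forms rho k h -> iota_antisymmetric h,
      invariant_cusp_forms rho k = [set (fun=> 0)]
    & forall M : {fset rat}, (forall m, m \in M -> 0 < m) ->
        (forall h : uhp R -> discC R L,
           cusp_forms rho k h -> menu_functional M h = 0) /\
        (forall Xi : uhp R -> discC R L,
           is_shadow rho k M Xi <-> Xi = (fun=> 0))].
Proof.
have k1 : 1 <= k by case: hk => j ->; have : 0 <= j%:R :> rat by []; lra.
have hN h : cusp_forms rho k h ->
    forall t g, (h t (- g) : R[i]) = - (h t g : R[i]).
  exact: cusp_form_antisym.
have cN h : cusp_forms rho k h -> iota_antisymmetric h.
  by move=> hh g m; apply: (fourier_antisym (hN h hh)); exact: fourier_coefP hh.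
have menu0 (M : {fset rat}) h : cusp_forms rho k h -> menu_functional M h = 0.
  move=> /cN hh; rewrite /menu_functional big1 // => m _; set S := \sum_(g | _) _.
  have : S = - S.
    (* Negation permutes the classes with q(g) = m mod 1 and flips the sign of each coefficient. *)
    rewrite {1}/S (reindex_inj oppr_inj) /= -sumrN.
    by apply: eq_big => [g|g _]; rewrite ?discqN // hh.
  by move/eqP; rewrite -addr_eq0 -mulr2n mulrn_eq0 => /eqP.
split=> //.
- apply/seteqP; split=> [h [hh hinv]|_ ->] /=; last first.
    split; first exact: cusp_form0.
    move=> s _ t; apply/ffunP => g.
    by rewrite -[g](permKV s) disc_permuteE !discC_zeroE.
  apply/funext => t; apply/ffunP => g; rewrite discC_zeroE.
  (* Negation is itself an isometry, so an invariant form is symmetric as well as antisymmetric. *)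
  have sN : disc_isometries (perm (@oppr_inj (disc L))).
    split=> [x y|x]; first by rewrite !permE opprD.
    by rewrite permE discqN.
  have := hN h hh t g; rewrite -{1}(hinv _ sN t).
  have -> : - g = perm (@oppr_inj (disc L)) g by rewrite permE.
  rewrite disc_permuteE => /eqP.
  by rewrite -addr_eq0 -mulr2n mulrn_eq0 => /eqP.
move=> M _; split=> [h|Xi]; first exact: menu0.
split=> [[hX XX]|->].
  (* Testing the representing property on [Xi] itself gives <Xi, Xi> = 0, against positivity of the
     norm. *)
  apply: contrapT => X0; have := petersson_pos k1 hX X0.
  by rewrite -XX // menu0 // ltxx.
split; first exact: cusp_form0.
by move=> h hh; rewrite petersson0r menu0.
Qed.
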